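(* Let $A$ be a commutative ring and $M$ an $A$-module. Let $x=(x_1,\dots,x_n)$ and $u=(u_1,\dots,u_n)$ be two sequences of elements of $A$, generating ideals $J_x\subset J_u$. Assume that $x$ is $M$-independent. Then: (1) The sequence $u$ is $M$-independent as well. (2) Let $W$ be any $n\times n$ matrix with entries in $A$ such that $x=uW$, where $x$ and $u$ are viewed as row matrices (such matrices exist since $J_x\subset J_u$), and let $\Delta$ be its determinant. Then we have the equalities of submodules of $M$ \[ (J_xM:J_u)=(J_x+(\Delta))M,\qquad (J_xM:(J_x+(\Delta)))=J_uM, \] and the equalities of ideals of $A$ \[ \operatorname{Ann}_A(J_uM/J_xM)=\operatorname{Ann}_A(M/(J_x+(\Delta))M),\qquad \operatorname{Ann}_A((J_x+(\Delta))M/J_xM)=\operatorname{Ann}_A(M/J_uM). \] (3) Let $W$ and $\Delta$ be as in (2). If moreover $\operatorname{Ann}_A(M/J_xM)=J_x$, then the sequences $x$ and $u$ are $A$-independent. In particular \[ (J_x:J_u)=J_x+(\Delta)=\operatorname{Ann}_A(M/(J_x+(\Delta))M), \qquad (J_x:J_x+(\Delta))=J_u=\operatorname{Ann}_A(M/J_uM). \] Moreover the initial Fitting ideal of $J_u/J_x$ over the ring $\overline A=A/J_x$ is generated by the image $\overline\Delta$ of $\Delta$: $\operatorname{Fit}_{\overline A}(J_u/J_x)=(\overline\Delta)$. (4) Let $W$ and $\Delta$ be as in (2). Assume that $M$ is nonzero and that one of the following holds: (a) $J_u$ is nilpotent; or (b) $M$ is of finite type over $A$ and $J_u$ is contained in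 the Jacobson radical of $A$; or (c) $\operatorname{Ann}_A(M/J_xM)=J_x$ and $J_u\ne A$. Then $\Delta\notin J_x$, and $\mu_A(J_u)=\mu_A(J_x)=n$.
   Context: A sequence $x_1,\dots,x_n$ of elements of a commutative ring $A$ is $M$-independent (for an $A$-module $M$) if for all $m_1,\dots,m_n\in M$, $\sum_i x_im_i=0$ implies $m_i\in(x_1,\dots,x_n)M$ for every $i$; $A$-independent means this with $M=A$. For a submodule $N\subset M$ and an ideal $I$ of $A$, $(N:I)=\{m\in M\mid am\in N\text{ for all }a\in I\}$ (for $M=A$ this is the usual colon ideal). $\operatorname{Fit}$ denotes the initial (zeroth) Fitting ideal of a finite type module. $\mu_A(N)$ denotes the minimal number of generators of an $A$-module $N$. *)

(* Defs.v *)
From HB Require Import structures.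
From mathcomp Require Import all_boot all_algebra.
From mathcomp Require Import boolp classical_sets.

Set Implicit Arguments.
Unset Strict Implicit.
Unset Printing Implicit Defensive.

Import GRing.Theory.
Local Open Scope ring_scope.
Local Open Scope quotient_scope.

(* Commutative rings are [comPzRingType]: the zero ring is allowed, and it does
   occur (A / I with I = A).  Membership is boolean by classical reflection
   ([asbool]); equality of submodules and ideals is [=i]. *)

(* The packaged submodules of mathcomp are [submodClosed V]. *)
Definition mk_submod (R : pzRingType) (V : lmodType R) (S : {pred V})
    (H : GRing.subsemimod_closed S) : submodClosed V :=
  HB.pack S (GRing.isSubSemiModClosed.Build R V S H).

(* An ideal of [R] is a submodule of the regular module [R^o]. *)
Notation idealT R := (submodClosed R^o).

Section Submodules.
Variables (R : pzRingType) (V : lmodType R).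
Implicit Types (S : set V) (N P : submodClosed V).

Definition span_pred S : {pred V} :=
  fun y => `[< forall N : submodClosed V, (forall z, S z -> z \in N) -> y \in N >].

Fact span_closed S : GRing.subsemimod_closed (span_pred S).
Proof.
split; [split=> [|y z] | move=> a y].
- by apply/asboolP => N _; exact: rpred0.
- move=> /asboolP Sy /asboolP Sz; apply/asboolP => N SN.
  by rewrite rpredD ?Sy ?Sz.
- by move=> /asboolP Sy; apply/asboolP => N SN; rewrite rpredZ ?Sy.
Qed.

Definition span S : submodClosed V := mk_submod (span_closed S).

Fact full_closed : GRing.subsemimod_closed (predT : {pred V}).
Proof. by []. Qed.

Definition fullsub : submodClosed V := mk_submod full_closed.

Definition addsub N P : submodClosed V := span [set y | y \in N \/ y \in P].

Definition smul (I : idealT R) N : submodClosed V :=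
  span [set z | exists a y, [/\ a \in I, y \in N & z = a *: y]].

Definition colon N (I : idealT R) : {pred V} :=
  fun m => `[< forall a : R, a \in I -> a *: m \in N >].

Definition generates k (g : 'I_k -> V) : Prop := span (range g) =i fullsub.

Definition Ann : {pred R^o} := fun a => `[< forall t : V, (a : R) *: t = 0 >].

End Submodules.

Definition gen_by (R : pzRingType) (V : lmodType R) (k : nat) : Prop :=
  exists g : 'I_k -> V, generates g.

Definition finite_type (R : pzRingType) (V : lmodType R) : Prop :=
  exists k, gen_by V k.

(* mu(V) = k *)
Definition min_ngens (R : pzRingType) (V : lmodType R) (k : nat) : Prop :=
  gen_by V k /\ forall l, gen_by V l -> (k <= l)%N.

(* The product I M, for I an ideal and M a whole module. *)
Notation ideal_mod I M := (smul I (fullsub M)).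

Section Ideals.
Variable R : pzRingType.
Implicit Types I J m : idealT R.

Definition principal (a : R) : idealT R := span [set (a : R^o)].

Definition ideal n (x : 'rV[R]_n) : idealT R :=
  span (range (fun i => x 0 i : R^o)).

Definition ideal_pow I k : idealT R := iter k (smul I) (fullsub R^o).

Definition nilpotent_ideal I : Prop :=
  exists k, forall a, a \in ideal_pow I k -> a = 0.

Definition maximal_ideal m : Prop :=
  ~ (m =i fullsub R^o) /\
  forall I, {subset m <= I} -> I =i m \/ I =i fullsub R^o.

Definition jacobson : {pred R^o} :=
  fun a => `[< forall m, maximal_ideal m -> a \in m >].

Definition independent (M : lmodType R) n (x : 'rV[R]_n) : Prop :=
  forall m : 'I_n -> M,
    \sum_i x 0 i *: m i = 0 -> forall i, m i \in ideal_mod (ideal x) M.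

End Ideals.
Arguments jacobson R : clear implicits.

Section QuotientModule.
Variables (R : pzRingType) (V : lmodType R) (N : submodClosed V).

Definition submod_pred (y : V) : bool := y \in N.

Fact submod_pred_closed : zmod_closed submod_pred.
Proof. exact: GRing.submod_closedB (GRing.submodClosedP N). Qed.

Definition submod_zmod : zmodClosed V :=
  HB.pack submod_pred (GRing.isZmodClosed.Build V submod_pred submod_pred_closed).

(* V / N *)
Definition quotient : Type := (Quotient.quot submod_zmod).
HB.instance Definition _ := GRing.Zmodule.on quotient.

Definition quot_pi (y : V) : quotient := \pi_(Quotient.quot submod_zmod) y.
Definition quot_rep (y : quotient) : V := repr (y : (Quotient.quot submod_zmod)).

Lemma quot_repK y : quot_pi (quot_rep y) = y.
Proof. exact: reprK. Qed.

Lemma quot_piE (y z : V) : quot_pi y = quot_pi z <-> y - z \in N.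
Proof.
rewrite -[_ \in N]/(y - z \in submod_zmod) Quotient.idealrBE.
by split=> [/eqP|/eqP].
Qed.

Lemma quot_piD y z : quot_pi (y + z) = quot_pi y + quot_pi z.
Proof. exact: (raddfD (\pi_(Quotient.quot submod_zmod))). Qed.

Definition quot_scale (a : R) (y : quotient) : quotient :=
  quot_pi (a *: quot_rep y).

Lemma quot_scaleE a (y : V) : quot_scale a (quot_pi y) = quot_pi (a *: y).
Proof.
by apply/quot_piE; rewrite -scalerBr rpredZ //; apply/quot_piE; rewrite quot_repK.
Qed.

Fact quot_scaleA a b y : quot_scale a (quot_scale b y) = quot_scale (a * b) y.
Proof. by rewrite -[y]quot_repK !quot_scaleE scalerA. Qed.
Fact quot_scale1 : left_id 1 quot_scale.
Proof. by move=> y; rewrite -[y]quot_repK quot_scaleE scale1r. Qed.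
Fact quot_scaleDr : right_distributive quot_scale +%R.
Proof.
by move=> a y z; rewrite -[y]quot_repK -[z]quot_repK -quot_piD !quot_scaleE scalerDr quot_piD.
Qed.
Fact quot_scaleDl y : {morph quot_scale^~ y : a b / a + b}.
Proof.
by move=> a b; rewrite /= -[y]quot_repK !quot_scaleE scalerDl quot_piD.
Qed.

HB.instance Definition _ := GRing.Zmodule_isLmodule.Build R quotient
  quot_scaleA quot_scale1 quot_scaleDr quot_scaleDl.

Fact quot_pi_is_zmod_morphism : zmod_morphism quot_pi.
Proof. by move=> y z; exact: (raddfB (\pi_(Quotient.quot submod_zmod))). Qed.
Fact quot_pi_is_scalable : scalable quot_pi.
Proof. by move=> a y; rewrite -quot_scaleE. Qed.

HB.instance Definition _ := GRing.isZmodMorphism.Build V quotient quot_pi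
  quot_pi_is_zmod_morphism.
HB.instance Definition _ := GRing.isScalable.Build R V quotient *:%R quot_pi
  quot_pi_is_scalable.

End QuotientModule.

Section SubModule.
Variables (R : pzRingType) (V : lmodType R) (N P : submodClosed V).

(* The submodule N as a module in its own right. *)
Record submodule := Submodule { submodule_val :> V; _ : submodule_val \in N }.
HB.instance Definition _ := [isSub for submodule_val].
HB.instance Definition _ := [Choice of submodule by <:].
HB.instance Definition _ := [SubChoice_isSubLmodule of submodule by <:].

Definition restrict_pred : {pred submodule} := fun y => val y \in P.

Lemma restrictE y : (y \in restrict_pred) = (val y \in P).
Proof. by []. Qed.

Fact restrict_closed : GRing.subsemimod_closed restrict_pred.
Proof.
split; [split=> [|y z] | move=> a y]; rewrite !restrictE.
- by rewrite raddf0 rpred0.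
- by move=> Py Pz; rewrite raddfD rpredD.
- by move=> Py; rewrite linearZ rpredZ.
Qed.

Definition restrict : submodClosed submodule := mk_submod restrict_closed.

(* The image of N in V / P; it is the quotient of N by P when P is contained in N,
   and that of N by its intersection with P in general. *)
Definition subquot : lmodType R := quotient restrict.

End SubModule.

Section QuotientRing.
Variables (A : comPzRingType) (J : idealT A).

Definition quot_ring : Type := quotient J.
HB.instance Definition _ := GRing.Zmodule.on quot_ring.

Definition quot_proj (a : A) : quot_ring := quot_pi J (a : A^o).
Definition quot_repr (a : quot_ring) : A := quot_rep (a : quotient J).

Lemma quot_reprK a : quot_proj (quot_repr a) = a.
Proof. exact: quot_repK. Qed.

Lemma quot_proj_eq (a b : A) :
  quot_proj a = quot_proj b <-> (a - b : A^o) \in J.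
Proof. exact: quot_piE. Qed.

Lemma quot_projD a b : quot_proj (a + b) = quot_proj a + quot_proj b.
Proof. exact: quot_piD. Qed.

Definition quot_mul (a b : quot_ring) : quot_ring :=
  quot_proj (quot_repr a * quot_repr b).

Lemma quot_mulE a b : quot_mul (quot_proj a) (quot_proj b) = quot_proj (a * b).
Proof.
apply/quot_proj_eq; set a' := quot_repr _; set b' := quot_repr _.
have -> : a' * b' - a * b = a' * (b' - b) + b * (a' - a).
  by rewrite !mulrBr addrA (mulrC b a') subrK (mulrC b a).
by rewrite rpredD //; apply: (@rpredZ _ A^o J);
  apply/quot_proj_eq; rewrite quot_reprK.
Qed.

Fact quot_mulA : associative quot_mul.
Proof.
move=> a b c; rewrite -[a]quot_reprK -[b]quot_reprK -[c]quot_reprK.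
by rewrite !quot_mulE mulrA.
Qed.
Fact quot_mulC : commutative quot_mul.
Proof. by move=> a b; rewrite /quot_mul mulrC. Qed.
Fact quot_mul1 : left_id (quot_proj 1) quot_mul.
Proof. by move=> a; rewrite -[a]quot_reprK quot_mulE mul1r. Qed.
Fact quot_mulDl : left_distributive quot_mul +%R.
Proof.
move=> a b c; rewrite -[a]quot_reprK -[b]quot_reprK -[c]quot_reprK.
by rewrite -quot_projD !quot_mulE mulrDl quot_projD.
Qed.

HB.instance Definition _ := GRing.Zmodule_isComPzRing.Build quot_ring
  quot_mulA quot_mulC quot_mul1 quot_mulDl.

Fact quot_proj_is_zmod_morphism : zmod_morphism quot_proj.
Proof. by move=> a b; exact: quot_pi_is_zmod_morphism. Qed.
Fact quot_proj_is_monoid_morphism : monoid_morphism quot_proj.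
Proof. by split=> // a b; rewrite -quot_mulE. Qed.

HB.instance Definition _ := GRing.isZmodMorphism.Build A quot_ring quot_proj
  quot_proj_is_zmod_morphism.
HB.instance Definition _ := GRing.isMonoidMorphism.Build A quot_ring quot_proj
  quot_proj_is_monoid_morphism.

End QuotientRing.

Section IdealQuotient.
Variables (A : comPzRingType) (I J : idealT A).

(* [subquot I J] is killed by J; [ideal_quot] is the same abelian group with
   the induced structure of module over the ring A / J. *)
Definition ideal_quot : Type := subquot I J.
HB.instance Definition _ := GRing.Zmodule.on ideal_quot.

Definition ideal_quot_scale (a : quot_ring J) (y : ideal_quot) : ideal_quot :=
  quot_repr a *: (y : subquot I J).

Lemma subquot_killed (a : A) (y : subquot I J) : (a : A^o) \in J -> a *: y = 0.
Proof.
move=> Ja; rewrite -[y]quot_repK -linearZ -[RHS](raddf0 (quot_pi _)).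
apply/quot_piE; rewrite subr0 restrictE linearZ /=.
rewrite (_ : _ *: _ = (val (quot_rep y) : A) *: (a : A^o)); last exact: mulrC.
exact: (@rpredZ _ A^o J).
Qed.

Lemma ideal_quot_scaleE (a : A) (y : ideal_quot) :
  ideal_quot_scale (quot_proj J a) y = a *: (y : subquot I J).
Proof.
apply/eqP; rewrite -subr_eq0 -scalerBl subquot_killed //.
by apply/quot_proj_eq; rewrite quot_reprK.
Qed.

Fact ideal_quot_scaleA a b y :
  ideal_quot_scale a (ideal_quot_scale b y) = ideal_quot_scale (a * b) y.
Proof.
rewrite -[a]quot_reprK -[b]quot_reprK -rmorphM !ideal_quot_scaleE.
exact: scalerA.
Qed.
Fact ideal_quot_scale1 : left_id 1 ideal_quot_scale.
Proof. by move=> y; rewrite -(rmorph1 (quot_proj J)) ideal_quot_scaleE scale1r. Qed.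
Fact ideal_quot_scaleDr : right_distributive ideal_quot_scale +%R.
Proof. by move=> a y z; exact: scalerDr. Qed.
Fact ideal_quot_scaleDl y : {morph ideal_quot_scale^~ y : a b / a + b}.
Proof.
move=> a b; rewrite /= -[a]quot_reprK -[b]quot_reprK -rmorphD.
by rewrite !ideal_quot_scaleE scalerDl.
Qed.

HB.instance Definition _ := GRing.Zmodule_isLmodule.Build (quot_ring J) ideal_quot
  ideal_quot_scaleA ideal_quot_scale1 ideal_quot_scaleDr ideal_quot_scaleDl.

End IdealQuotient.

Section Fitting.
Variables (R : comPzRingType) (V : lmodType R).

Definition relations r (g : 'I_r -> V) k (X : 'M[R]_(k, r)) : Prop :=
  forall i, \sum_j X i j *: g j = 0.

(* The initial Fitting ideal computed from the generating family g: the ideal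
   generated by the r x r minors of the matrix of all relations of g. *)
Definition Fit_gen r (g : 'I_r -> V) : idealT R :=
  span [set d : R^o | exists2 X : 'M[R]_r, relations g X & d = \det X].

(* The ideal generated by the [Fit_gen g], for all finite generating families g.
   All of them are equal, see [FitE]. *)
Definition Fit : idealT R :=
  span [set d : R^o | exists r (g : 'I_r -> V),
                        generates g /\ d \in Fit_gen g].

Lemma mem_span (W : lmodType R) (S : set W) y : S y -> y \in span S.
Proof. by move=> Sy; apply/asboolP => N; exact. Qed.

Lemma span_sub (W : lmodType R) (S : set W) (N : submodClosed W) :
  (forall y, S y -> y \in N) -> {subset span S <= N}.
Proof. by move=> SN y /asboolP; exact. Qed.

Lemma span_rangeP (W : lmodType R) k (g : 'I_k -> W) y :
  y \in span (range g) -> exists c : 'I_k -> R, y = \sum_i c i *: g i.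
Proof.
pose P : {pred W} := fun y => `[< exists c : 'I_k -> R, y = \sum_i c i *: g i >].
have PC : GRing.subsemimod_closed P.
  split; [split=> [|y1 y2] | move=> a y1].
  - apply/asboolP; exists (fun=> 0); rewrite big1 // => i _.
    by rewrite scale0r.
  - move=> /asboolP[c ->] /asboolP[d ->]; apply/asboolP.
    exists (fun i => c i + d i); rewrite -big_split.
    by apply: eq_bigr => i _; rewrite scalerDl.
  - move=> /asboolP[c ->]; apply/asboolP; exists (fun i => a * c i).
    by rewrite scaler_sumr; apply: eq_bigr => i _; rewrite scalerA.
move=> /(span_sub (N := mk_submod PC)) H.
apply/asboolP; apply: H => _ [i _ <-]; apply/asboolP; exists (fun j => (j == i)%:R).
rewrite (bigD1 i) //= eqxx scale1r big1 ?addr0 // => j /negPf ->.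
by rewrite scale0r.
Qed.

Lemma det_Fit_gen r (g : 'I_r -> V) s (X : 'M[R]_(s + r)) :
  (forall i, \sum_j X i (rshift s j) *: g j = 0) ->
  (\det X : R^o) \in Fit_gen g.
Proof.
elim: s X => [|s IHs] X gX.
  apply: mem_span; exists X => // i; rewrite -[RHS](gX i).
  by apply: eq_bigr => j _; congr (X _ _ *: _); apply: val_inj.
rewrite (expand_det_col X ord0) rpred_sum // => i _.
rewrite (@rpredZ _ R^o) // (@rpredZ _ R^o) //; apply: IHs => k.
rewrite -[RHS](gX (lift i k)); apply: eq_bigr => j _; rewrite !mxE.
by congr (X _ _ *: _); apply: val_inj.
Qed.

Lemma Fit_gen_sub r (g : 'I_r -> V) s (h : 'I_s -> V) :
  generates g -> generates h -> {subset Fit_gen h <= Fit_gen g}.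
Proof.
move=> gV hV; apply: span_sub => _ [X hX ->].
have /choice[p hp] : forall i, exists c : 'I_r -> R, h i = \sum_j c j *: g j.
  by move=> i; apply: span_rangeP; rewrite gV.
have /choice[q gq] : forall i, exists c : 'I_s -> R, g i = \sum_j c j *: h j.
  by move=> i; apply: span_rangeP; rewrite hV.
pose P : 'M_(s, r) := \matrix_(i, j) p i j.
pose Q : 'M_(r, s) := \matrix_(i, j) q i j.
(* family (h, g); rows: relations X on h, and  g - Q h = 0 *)
pose Y : 'M_(s + r) := block_mx X 0 (- Q) 1%:M.
pose U : 'M_(s + r) := block_mx 1%:M P 0 1%:M.
have -> : \det X = \det (Y *m U).
  by rewrite det_mulmx det_lblock det_ublock !det1 !mulr1.
have gP i : \sum_j P i j *: g j = h i.
  by rewrite hp; apply: eq_bigr => j _; rewrite mxE.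
have mulP k (Z : 'M_(k, s)) i :
    \sum_j (Z *m P) i j *: g j = \sum_l Z i l *: h l.
  under eq_bigr => j _ do rewrite mxE scaler_suml.
  rewrite exchange_big; apply: eq_bigr => l _.
  by rewrite -gP scaler_sumr; apply: eq_bigr => j _; rewrite scalerA.
apply: det_Fit_gen => i; rewrite /Y /U mulmx_block.
rewrite !mul0mx !mulmx0 !mulmx1 !addr0.
case: (split_ordP i) => i' ->.
  under eq_bigr => j _ do rewrite block_mxEur.
  by rewrite mulP hX.
under eq_bigr => j _ do rewrite block_mxEdr mxE scalerDl.
rewrite big_split /= mulP [X in _ + X](bigD1 i') //=.
rewrite [in X in _ + (X + _)]mxE eqxx scale1r.
rewrite [X in _ + (_ + X)]big1 => [|j ji]; last by rewrite mxE eq_sym (negPf ji) scale0r.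
rewrite addr0 [X in _ + X]gq -big_split big1 // => l _.
by rewrite /= !mxE scaleNr addNr.
Qed.

Lemma FitE r (g : 'I_r -> V) : generates g -> Fit =i Fit_gen g.
Proof.
move=> gV y; apply/idP/idP => [|yg]; last first.
  by apply: mem_span; exists r, g.
by apply: span_sub => d [s [h [hV]]]; apply: Fit_gen_sub.
Qed.

End Fitting.

(* Main.v *)
Require Import Defs.
From mathcomp Require Import all_boot all_algebra.
From mathcomp Require Import boolp classical_sets.

Set Implicit Arguments.
Unset Strict Implicit.
Unset Printing Implicit Defensive.

Import GRing.Theory.
Local Open Scope ring_scope.

(* Since u W adj(W) = \Delta u, the ideal J_x contains \Delta J_u; this gives the easy
   inclusions of (2).  The reverse inclusions compare the Koszul complexes of x and u
   through the exterior powers of W.  The point is that M-independence of x propagates to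
   all Koszul degrees: an equality \sum_i x_i y_i = 0 between elements of the exterior
   algebra with coefficients in M forces the coefficients of the y_i into J_x M.  Let
   W_p be the columns of W, so that u(W_p) = x_p.  If \Delta m lies in J_x M, then
   W_1 ^ ... ^ W_n m = 0 modulo J_x M, and removing the W_p one at a time shows that m is a
   u-boundary modulo J_x M, i.e. m is in J_u M.  If J_u m lies in J_x M, then m is
   successively replaced by forms t_k of degree k such that
   <W_1 ^ ... ^ W_k, t_k> = m modulo J_x M; for k = n this says that m is in
   \Delta M + J_x M.
   Independence of u follows: if \sum_j u_j m_j = 0, then x (adj(W) m) = \Delta u m = 0,
   so W adj(W) m = \Delta m has coefficients in J_x M.  For the Fitting ideal, the
   determinant of a matrix of relations kills J_u / J_x, hence belongs to (J_x : J_u).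
   In (4), \Delta in J_x or a shorter system of generators would imply M = J_u M. *)

(** * Exterior algebra with coefficients in a module: products, contractions, pairing *)

Section ExteriorAlgebra.
Variables (A : comPzRingType) (n : nat).
Implicit Types (j l : 'I_n) (K : {set 'I_n}) (u w : 'I_n -> A).

Definition below j K : nat := #|[set i in K | (i < j)%N]|.
(** For j outside K this is the sign in e_j ^ e_K = sg j K * e_(j |: K). The strict inequality in
    [below] gives K and K :\ j the same sign at j, so [wedge] and [contr] can share it. *)
Definition sg j K : A := (-1) ^+ below j K.

Lemma sgU j l K : j \notin K -> sg l (j |: K) = (-1) ^+ (j < l)%N * sg l K.
Proof.
move=> jK; rewrite /sg -exprD; congr (_ ^+ _); rewrite /below.
have -> : [set i in j |: K | (i < l)%N]
   = (if (j < l)%N then j |: [set i in K | (i < l)%N] else [set i in K | (i < l)%N]).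
  case: ifP => jl; apply/setP => i; rewrite !inE; case: (eqVneq i j) => [->|_] //=.
    by rewrite jl andbF.
by case: ifP => // jl; rewrite cardsU1 inE (negPf jK).
Qed.

(** Anticommutation of e_j and e_l, read on the signs. *)
Lemma sg_swap j l K : j != l -> j \notin K -> l \notin K ->
  sg j K * sg l (j |: K) = - (sg l K * sg j (l |: K)).
Proof.
move=> jl jK lK; rewrite !sgU //; case: (ltngtP j l) jl => [||/val_inj->]; rewrite ?eqxx //.
  by move=> _ _; rewrite expr1 expr0 mul1r mulN1r mulrN mulrC.
by move=> _ _; rewrite expr1 expr0 mul1r mulN1r mulrN opprK mulrC.
Qed.

Lemma sg_sq j K : sg j K * sg j K = 1.
Proof. by rewrite -expr2 /sg sqrr_sign. Qed.

Section Values.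
Variable M : lmodType A.
Implicit Types (t : {set 'I_n} -> M).

(* A function t : {set 'I_n} -> M stands for the element \sum_K t(K) e_K of the
   exterior algebra of A^n with coefficients in M, where e_K is the product of the
   e_k, k in K, in increasing order; [wedge w] is the left product by w, [contr u]
   the contraction by the linear form e_j |-> u_j (the Koszul differential). *)
Definition wedge w t K : M := \sum_(j in K) (sg j K * w j) *: t (K :\ j).
Definition contr u t K : M := \sum_(j | j \notin K) (sg j K * u j) *: t (j |: K).
Definition pairing (om : {set 'I_n} -> A) t : M := \sum_K om K *: t K.

Lemma contrB u t t' K :
  contr u (fun K => t K - t' K) K = contr u t K - contr u t' K.
Proof. by rewrite /contr -sumrB; apply: eq_bigr => j _; rewrite scalerBr. Qed.

Lemma contr_sum u (I : finType) (a : I -> A) (y : I -> {set 'I_n} -> M) K :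
  contr u (fun K => \sum_i a i *: y i K) K = \sum_i a i *: contr u (y i) K.
Proof.
rewrite /contr; under eq_bigr => j _ do rewrite scaler_sumr.
rewrite exchange_big; apply: eq_bigr => i _; rewrite scaler_sumr.
by apply: eq_bigr => j _; rewrite !scalerA mulrC.
Qed.

Lemma wedge_sum u (I : finType) (a : I -> A) (y : I -> {set 'I_n} -> M) K :
  wedge u (fun K => \sum_i a i *: y i K) K = \sum_i a i *: wedge u (y i) K.
Proof.
rewrite /wedge; under eq_bigr => j _ do rewrite scaler_sumr.
rewrite exchange_big; apply: eq_bigr => i _; rewrite scaler_sumr.
by apply: eq_bigr => j _; rewrite !scalerA mulrC.
Qed.

Lemma pairing_sum om (I : finType) (a : I -> A) (y : I -> {set 'I_n} -> M) :
  pairing om (fun K => \sum_i a i *: y i K) = \sum_i a i *: pairing om (y i).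
Proof.
rewrite /pairing; under eq_bigr => K _ do rewrite scaler_sumr.
rewrite exchange_big; apply: eq_bigr => i _; rewrite scaler_sumr.
by apply: eq_bigr => K _; rewrite !scalerA mulrC.
Qed.

Lemma pairing_suml (I : finType) (a : I -> A) (om : I -> {set 'I_n} -> A) t :
  pairing (fun K => \sum_i a i * om i K) t = \sum_i a i *: pairing (om i) t.
Proof.
rewrite /pairing; under eq_bigr => K _ do rewrite scaler_suml.
rewrite exchange_big; apply: eq_bigr => i _; rewrite scaler_sumr.
by apply: eq_bigr => K _; rewrite !scalerA.
Qed.

(** The terms above and below the diagonal cancel in pairs. The diagonal has its own hypothesis
    because F j j = - F j j does not force F j j = 0 when 2 kills elements of M. *)
Lemma sum_skew (F : 'I_n -> 'I_n -> M) :
  (forall j, F j j = 0) -> (forall j l, F j l = - F l j) ->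
  \sum_j \sum_l F j l = 0.
Proof.
move=> F0 FN.
have E : \sum_j \sum_l F j l =
    \sum_(j : 'I_n) \sum_(l : 'I_n | (j < l)%N) F j l +
    \sum_(j : 'I_n) \sum_(l : 'I_n | (l < j)%N) F j l.
  rewrite -big_split; apply: eq_bigr => j _ /=.
  rewrite (bigID (fun l : 'I_n => (j < l)%N)) /=; congr (_ + _).
  rewrite (bigD1 j) ?ltnn //= F0 add0r; apply: eq_bigl => l.
  by rewrite -leqNgt ltn_neqAle andbC.
rewrite E [X in _ + X](exchange_big_dep xpredT) //= -big_split big1 // => j _ /=.
by rewrite -big_split big1 // => l _; rewrite /= FN addNr.
Qed.

Lemma contr_contr u t K : contr u (contr u t) K = 0.
Proof.
rewrite /contr; under eq_bigr => j jK do rewrite scaler_sumr big_mkcond /=.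
rewrite big_mkcond /=.
rewrite (eq_bigr (fun j => \sum_l if [&& j \notin K, l \notin K & l != j] then
   (sg j K * u j) *: ((sg l (j |: K) * u l) *: t (l |: (j |: K))) else 0)); last first.
  move=> j _; case: ifP => jK /=; last by rewrite big1.
  by apply: eq_bigr => l _; rewrite !inE negb_or andbC.
apply: sum_skew => [j|j l]; first by rewrite eqxx !andbF.
rewrite andbCA eq_sym; case: ifP; last by rewrite oppr0.
case/and3P=> lK jK jl; rewrite !scalerA -scaleNr.
rewrite [l |: (j |: K)]finset.setUCA; congr (_ *: _).
by rewrite mulrACA sg_swap // mulNr [u j * _]mulrC mulrACA.
Qed.

(** Contraction is an antiderivation. In either composite, the terms where the same index is
    inserted and removed give u_j w_j t(K), from j outside K in the first and from j in K in the
    second; the terms with two distinct indices cancel by [sg_swap]. *)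
Lemma contr_wedge u w t K :
  contr u (wedge w t) K + wedge w (contr u t) K = (\sum_j u j * w j) *: t K.
Proof.
rewrite /contr /wedge.
rewrite (eq_bigr (fun j => (u j * w j) *: t K +
  \sum_(l in K) (sg j K * u j) *: ((sg l (j |: K) * w l) *: t ((j |: K) :\ l)))); last first.
  move=> j jK; rewrite scaler_sumr (bigD1 j) ?setU11 //=; congr (_ + _).
    rewrite setU1K // scalerA sgU // ltnn expr0 mul1r mulrACA sg_sq mul1r //.
  apply: eq_bigl => l; rewrite !inE; case: eqVneq => //= [->|]; first by rewrite (negPf jK).
  by rewrite andbT.
rewrite [X in _ + X](eq_bigr (fun l => (u l * w l) *: t K +
  \sum_(j | j \notin K) (sg l K * w l) *: ((sg j (K :\ l) * u j) *: t (j |: (K :\ l))))); last first.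
  move=> l lK; rewrite scaler_sumr (bigD1 l) ?setD11 //=; congr (_ + _).
    rewrite finset.setD1K // scalerA -{1}(finset.setD1K lK) sgU ?setD11 //.
    by rewrite ltnn expr0 mul1r mulrACA sg_sq mul1r mulrC.
  apply: eq_bigl => j; rewrite !inE; case: eqVneq => //= [->|]; first by rewrite lK.
  by rewrite andbT.
rewrite !big_split /= addrACA scaler_suml (bigID (fun j => j \notin K) predT) /=.
under [X in _ = _ + X]eq_bigl => j do rewrite negbK.
rewrite -[RHS]addr0; congr (_ + _).
rewrite [X in _ + X](exchange_big_dep (fun j => j \notin K)) //= -big_split big1 // => j jK.
rewrite /= [X in _ + X](eq_bigl (mem K)) => [|l]; last by rewrite jK andbT.
rewrite -big_split big1 // => l lK /=; rewrite !scalerA.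
have jl : j != l by apply: contraNneq jK => ->.
have -> : (j |: K) :\ l = j |: (K :\ l).
  apply/setP => i; rewrite !inE; case: (eqVneq i l) => [->|]; rewrite ?andbT //=.
  by rewrite eq_sym (negPf jl).
rewrite -scalerDl -[RHS](scale0r (t (j |: (K :\ l)))); congr (_ *: _).
have lK' : l \notin K :\ l by rewrite setD11.
have jK' : j \notin K :\ l by rewrite !inE negb_and jK orbT.
have := sg_swap jl jK' lK'; rewrite finset.setD1K // => E.
rewrite [X in _ + X]mulrACA [sg l K * _]mulrC.
rewrite sgU // -[in sg l K](finset.setD1K lK) -[in sg j K](finset.setD1K lK) !sgU // ltnn.
rewrite expr0 mul1r mulrACA [w l * _]mulrC -mulrDl.
case: (ltngtP j l) jl => [||/val_inj->]; rewrite ?eqxx // => _ _.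
  by rewrite !expr0 !expr1 !mul1r mulN1r mulrN addNr mul0r.
by rewrite !expr0 !expr1 !mul1r mulN1r mulNr addNr mul0r.
Qed.

End Values.

Lemma pairing_wedge (M : lmodType A) (om : {set 'I_n} -> A^o) u (t : {set 'I_n} -> M) :
  pairing om (wedge u t) = pairing (contr u om) t.
Proof.
rewrite /pairing /wedge /contr.
under eq_bigr => K _ do rewrite scaler_sumr.
under [RHS]eq_bigr => K _ do rewrite scaler_suml.
rewrite (exchange_big_dep xpredT) //= [RHS](exchange_big_dep xpredT) //=.
apply: eq_bigr => j _.
(* Inserting j is a bijection from the sets avoiding j to those containing j. *)
rewrite (reindex_onto (fun K => j |: K) (fun K => K :\ j)) /=; last first.
  by move=> K; exact: finset.setD1K.
rewrite [LHS](eq_bigl (fun K => j \notin K)); last first.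
  move=> K; rewrite setU11 /=; apply/eqP/idP => [<-|]; first by rewrite setD11.
  exact: setU1K.
apply: eq_bigr => K jK; rewrite setU1K // scalerA sgU // ltnn expr0 mul1r.
by congr (_ *: _); rewrite mulrC.
Qed.

Lemma wedge_wedge (M : lmodType A) u (t : {set 'I_n} -> M) K :
  wedge u (wedge u t) K = 0.
Proof.
(* The value at K is the pairing with the indicator of K, so the claim is dual to [contr_contr]. *)
pose d K' : A^o := (K' == K)%:R.
have pd (t' : {set 'I_n} -> M) : t' K = pairing d t'.
  rewrite /pairing (bigD1 K) //= /d eqxx scale1r big1 ?addr0 // => K' /negPf ->.
  by rewrite scale0r.
rewrite pd !pairing_wedge /pairing big1 // => K' _.
by rewrite contr_contr scale0r.
Qed.

Section Products.
Variables (M : lmodType A) (m : M).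

Definition one_at K : M := if K == finset.set0 then m else 0.
Definition wedges (vs : seq ('I_n -> A)) : {set 'I_n} -> M :=
  foldr (fun v t => wedge v t) one_at vs.

Lemma wedges_deg vs K : #|K| != size vs -> wedges vs K = 0.
Proof.
elim: vs K => [|v vs IH] K /= Kvs.
  by rewrite /one_at -cards_eq0 (negPf Kvs).
rewrite /wedge big1 // => j jK; rewrite IH ?scaler0 //.
by move: Kvs; rewrite (cardsD1 j K) jK add1n eqSS.
Qed.

(** The coefficients of a product of vectors are the maximal minors of its matrix. Induction on k by
    Laplace expansion along the first row: deleting f q replaces f by f \o lift q, whence the
    general increasing f. *)
Lemma wedges_det k (V : 'I_k -> 'I_n -> A) (f : 'I_k -> 'I_n) :
  {mono f : p q / (p < q)%N} ->
  wedges [seq V p | p <- enum 'I_k] [set f q | q : 'I_k]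
    = \det (\matrix_(p, q) V p (f q)) *: m.
Proof.
elim: k V f => [|k IH] V f fmono.
  rewrite det_mx00 scale1r; have -> : enum 'I_0 = [::] by apply: size0nil; rewrite size_enum_ord.
  rewrite /= /one_at (_ : _ == _) //; apply/eqP/setP => i; rewrite inE.
  by apply/imsetP => -[[]].
have finj : injective f.
  move=> p q fpq; apply/val_inj/eqP; rewrite /= eqn_leq (leqNgt p) (leqNgt q)
    -(fmono q p) -(fmono p q).
  by rewrite fpq ltnn.
rewrite enum_ordSl /= -map_comp /wedge big_imset /=; last by move=> p q _ _; exact: finj.
rewrite (expand_det_row _ ord0) scaler_suml; apply: eq_bigr => q _.
have -> : [set f q | q : 'I_k.+1] :\ f q = [set (f \o lift q) p | p : 'I_k].
  apply/setP => i; rewrite !inE; apply/andP/imsetP => [[iq /imsetP[p _ ip]]|[p _ ->]].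
    case: (unliftP q p) => [p' pE|pE]; last by move: iq; rewrite ip pE eqxx.
    by exists p' => //; rewrite ip pE.
  rewrite /= (inj_eq finj) eq_sym neq_lift; split=> //.
  by apply/imsetP; exists (lift q p).
rewrite (IH (fun p => V (lift ord0 p)) (f \o lift q)); last first.
  by move=> p p'; rewrite /= fmono /= !ltnNge leq_bump2.
rewrite scalerA; congr (_ *: _); rewrite mxE mulrC mulrA mulrC; congr (_ * _).
rewrite mulrC [in RHS]/cofactor add0n; congr (_ * _).
  rewrite /sg; congr (_ ^+ _); rewrite /below.
  (* Since f is increasing, exactly q indices of its image lie below f q: this is the cofactor
     sign. *)
  have -> : [set i in [set f q | q : 'I_k.+1] | (i < f q)%N] = f @: [set p : 'I_k.+1 | (p < q)%N].
    apply/setP => i; rewrite !inE; apply/andP/imsetP => [[/imsetP[p _ ->]]|[p]].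
      by rewrite fmono => pq; exists p; rewrite ?inE.
    by rewrite inE => pq ->; rewrite fmono pq; split=> //; apply: imset_f.
  have qk : (q <= k.+1)%N := ltnW (ltn_ord q).
  have -> : [set p : 'I_k.+1 | (p < q)%N] = widen_ord qk @: [set: 'I_q].
    apply/setP => p; rewrite inE; apply/idP/imsetP => [pq|[i _ ->]]; last exact: (ltn_ord i).
    by exists (Ordinal pq); rewrite ?inE //; apply: val_inj.
  by rewrite !card_imset ?cardsT ?card_ord // => i j /(congr1 val) /= /val_inj.
by congr (\det _); apply/matrixP => p p'; rewrite !mxE.
Qed.

Lemma wedges_full (W : 'M[A]_n) K :
  wedges [seq W^~ p | p <- enum 'I_n] K = if K == [set: 'I_n] then \det W *: m else 0.
Proof.
case: eqVneq => [->|KT]; last first.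
  rewrite wedges_deg // size_map size_enum_ord; apply: contraNneq KT => Kn.
  by rewrite eqEcard finset.subsetT cardsT card_ord Kn /=.
have -> : [set: 'I_n] = [set id q | q : 'I_n] by apply/setP => i; rewrite inE imset_f.
rewrite (wedges_det (fun p => W^~ p)) // -det_tr; congr (\det _ *: _).
by apply/matrixP => i j; rewrite !mxE.
Qed.

End Products.
End ExteriorAlgebra.

(** * Elements of ideals, sums and products described by explicit combinations *)

Section Membership.
Variable A : comPzRingType.

Lemma mem_ideal n (x : 'rV[A]_n) i : (x 0 i : A^o) \in ideal x.
Proof. by apply: mem_span; exists i. Qed.

Lemma idealP n (x : 'rV[A]_n) (a : A^o) :
  a \in ideal x <-> exists c : 'I_n -> A, a = \sum_i c i * x 0 i.
Proof.
split=> [/span_rangeP //|[c ->]].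
by apply: rpred_sum => i _; apply: (@rpredZ _ A^o); apply: mem_ideal.
Qed.

Lemma ideal_sub n (x : 'rV[A]_n) (I : idealT A) :
  (forall i, (x 0 i : A^o) \in I) -> {subset ideal x <= I}.
Proof. by move=> xI; apply: span_sub => _ [i _ <-]. Qed.

Lemma principalP (d : A) (a : A^o) : a \in principal d <-> exists c : A, a = c * d.
Proof.
split=> [|[c ->]]; last by apply: (@rpredZ _ A^o); apply: mem_span.
pose x : 'rV[A]_1 := \row_j d; move=> da.
have /idealP[c ->] : a \in ideal x.
  by move: a da; apply: span_sub => _ ->; have := mem_ideal x 0; rewrite mxE.
by exists (c 0); rewrite big_ord1 mxE.
Qed.

Lemma addsubP (V : lmodType A) (N P : submodClosed V) y :
  y \in addsub N P <-> exists p q, [/\ p \in N, q \in P & y = p + q].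
Proof.
split=> [|[p [q [Np Pq ->]]]]; last by rewrite rpredD //; apply: mem_span; [left|right].
pose S : {pred V} := fun y => `[< exists p q, [/\ p \in N, q \in P & y = p + q] >].
have SC : GRing.subsemimod_closed S.
  split; [split=> [|y1 y2] | move=> a y1].
  - by apply/asboolP; exists 0, 0; rewrite !rpred0 addr0.
  - move=> /asboolP[p [q [Np Pq ->]]] /asboolP[p' [q' [Np' Pq' ->]]]; apply/asboolP.
    by exists (p + p'), (q + q'); rewrite !rpredD //; split=> //; rewrite addrACA.
  - move=> /asboolP[p [q [Np Pq ->]]]; apply/asboolP.
    by exists (a *: p), (a *: q); rewrite !rpredZ //; split=> //; rewrite scalerDr.
move=> yNP; apply/asboolP; move: y yNP.
apply: (span_sub (N := mk_submod SC)) => z Hz; apply/asboolP.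
by case: Hz => [Nz|Pz]; [exists z, 0|exists 0, z]; rewrite ?rpred0 ?addr0 ?add0r.
Qed.

Lemma smul_mem (V : lmodType A) (I : idealT A) (N : submodClosed V) (a : A) y :
  (a : A^o) \in I -> y \in N -> a *: y \in smul I N.
Proof. by move=> Ia Ny; apply: mem_span; exists a, y. Qed.

Lemma smul_sub (V : lmodType A) (I : idealT A) (N P : submodClosed V) :
  (forall (a : A) y, (a : A^o) \in I -> y \in N -> a *: y \in P) ->
  {subset smul I N <= P}.
Proof. by move=> IP; apply: span_sub => _ [a [y [Ia Ny ->]]]; apply: IP. Qed.

Lemma smul_subl (V : lmodType A) (I J : idealT A) (N : submodClosed V) :
  {subset I <= J} -> {subset smul I N <= smul J N}.
Proof. by move=> IJ; apply: smul_sub => a y /IJ; apply: smul_mem. Qed.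

Lemma ideal_modP (M : lmodType A) n (x : 'rV[A]_n) (m : M) :
  m \in ideal_mod (ideal x) M <-> exists c : 'I_n -> M, m = \sum_i x 0 i *: c i.
Proof.
split=> [|[c ->]]; last first.
  by apply: rpred_sum => i _; apply: smul_mem; first exact: mem_ideal.
pose S : {pred M} := fun y => `[< exists c : 'I_n -> M, y = \sum_i x 0 i *: c i >].
have SC : GRing.subsemimod_closed S.
  split; [split=> [|y1 y2] | move=> a y1].
  - by apply/asboolP; exists (fun=> 0); rewrite big1 // => i _; rewrite scaler0.
  - move=> /asboolP[c ->] /asboolP[d ->]; apply/asboolP; exists (fun i => c i + d i).
    by rewrite -big_split; apply: eq_bigr => i _; rewrite scalerDr.
  - move=> /asboolP[c ->]; apply/asboolP; exists (fun i => a *: c i).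
    by rewrite scaler_sumr; apply: eq_bigr => i _; rewrite !scalerA mulrC.
move=> mx; apply/asboolP; move: m mx; apply: (smul_sub (P := mk_submod SC)).
move=> a y /idealP[c ->] _; apply/asboolP; exists (fun i => c i *: y).
by rewrite scaler_suml; apply: eq_bigr => i _; rewrite scalerA mulrC.
Qed.

Lemma ideal_mod_regular (I : idealT A) : ideal_mod I A^o =i I.
Proof.
move=> a; apply/idP/idP => [|Ia]; last first.
  have -> : a = (a : A) *: (1 : A^o) by rewrite /GRing.scale /= mulr1.
  exact: smul_mem.
move: a; apply: smul_sub => a y Ia _.
by rewrite (_ : a *: y = (y : A) *: (a : A^o)) ?rpredZ //; apply: mulrC.
Qed.

End Membership.

(** * Koszul comparison of x and u: the two hard inclusions between colons *)

Section Independence.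
Variables (A : comPzRingType) (M : lmodType A) (n : nat) (x u : 'rV[A]_n).
Variable W : 'M[A]_n.
Hypotheses (xM : independent M x) (xuW : x = u *m W).
Implicit Types (s : seq 'I_n).

Let wedge_cols (N : lmodType A) (m : N) s := wedges m [seq W^~ p | p <- s].

(** The coefficient of x_i when W_s m is contracted by u, from the recursion u(W_p ^ t) = x_p t -
    W_p ^ u(t). For s without repetition it is, up to sign, the product with W_i removed, or 0 if i
    is not in s. *)
Fixpoint contr_coef (N : lmodType A) (m : N) s (i : 'I_n) (K : {set 'I_n}) : N :=
  if s is p :: s' then
    (if i == p then wedge_cols m s' K else 0) - wedge (W^~ p) (contr_coef m s' i) K
  else 0.

Lemma contr_wedge_cols (N : lmodType A) (m : N) s K :
  contr (u 0) (wedge_cols m s) K = \sum_i x 0 i *: contr_coef m s i K.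
Proof.
elim: s K => [|p s IH] K /=.
  rewrite [RHS]big1 => [|i _]; last by rewrite scaler0.
  rewrite /contr big1 // => j jK; rewrite /wedge_cols /= /one_at.
  by case: eqP => [/setP/(_ j)|_]; rewrite ?scaler0 // !inE eqxx.
have := contr_wedge (u 0) (W^~ p) (wedge_cols m s) K.
move/(canRL (addrK _)) => /= ->.
under [RHS]eq_bigr => i _ do rewrite scalerBr.
rewrite sumrB; congr (_ - _).
  rewrite [RHS](bigD1 p) //= eqxx [X in _ + X]big1 ?addr0 => [|i /negPf ->]; last first.
    by rewrite scaler0.
  by rewrite xuW mxE.
rewrite {1}/wedge; under eq_bigr => j _ do rewrite IH scaler_sumr.
rewrite exchange_big; apply: eq_bigr => i _; rewrite /wedge scaler_sumr.
by apply: eq_bigr => j _; rewrite !scalerA mulrC.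
Qed.

Lemma contr_coef_notin (N : lmodType A) (m : N) s i K :
  i \notin s -> contr_coef m s i K = 0.
Proof.
elim: s K => // p s IH K; rewrite inE negb_or => /andP[/negPf ip si] /=.
by rewrite ip /wedge big1 ?subr0 // => j _; rewrite IH // scaler0.
Qed.

Lemma contr_coef_head (N : lmodType A) (m : N) p s K :
  p \notin s -> contr_coef m (p :: s) p K = wedge_cols m s K.
Proof.
move=> ps; rewrite /= eqxx /wedge big1 ?subr0 // => j _.
by rewrite contr_coef_notin // scaler0.
Qed.

Lemma ideal_mod_choice (t : {set 'I_n} -> M) :
  (forall K, t K \in ideal_mod (ideal x) M) ->
  exists y : 'I_n -> {set 'I_n} -> M, forall K, t K = \sum_i x 0 i *: y i K.
Proof.
move=> tx; have /choice[c cE] : forall K, exists c : 'I_n -> M, t K = \sum_i x 0 i *: c i.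
  by move=> K; apply/ideal_modP.
by exists (fun i K => c K i).
Qed.

Lemma ideal_mod_sub_u : {subset ideal_mod (ideal x) M <= ideal_mod (ideal u) M}.
Proof.
apply: smul_subl; apply: ideal_sub => i; apply/idealP.
by exists (W^~ i); rewrite xuW mxE; apply: eq_bigr => j _; rewrite mulrC.
Qed.

Lemma indepB (c d : 'I_n -> M) : \sum_i x 0 i *: c i = \sum_i x 0 i *: d i ->
  forall i, c i - d i \in ideal_mod (ideal x) M.
Proof.
move=> /eqP; rewrite -subr_eq0 -sumrB => /eqP cd.
apply: (xM (m := fun i => c i - d i)); rewrite -[RHS]cd.
by apply: eq_bigr => i _; rewrite scalerBr.
Qed.

(* Modulo J_x, W_p ^ W_s m being a Koszul u-boundary implies the same of W_s m: contract
   by u, which kills the boundary, and compare the coefficients of x_p. *)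
Lemma contr_descent m s : uniq s ->
  (exists b, forall K, wedge_cols m s K - contr (u 0) b K \in ideal_mod (ideal x) M) ->
  m \in ideal_mod (ideal u) M.
Proof.
elim: s => [_|p s IH]; last rewrite cons_uniq => /andP[ps us]; case=> b bE.
  have := bE finset.set0; rewrite /wedge_cols [wedges _ _ _]/= /one_at eqxx.
  move=> /ideal_mod_sub_u m0.
  rewrite -[m](subrK (contr (u 0) b finset.set0)) rpredD //.
  by apply: rpred_sum => j _; rewrite mulrC -scalerA; apply: smul_mem; first exact: mem_ideal.
have [y yE] := ideal_mod_choice bE.
(* The error term is \sum_i x_i y_i, and the boundary of y_p approximates W_s m. *)
apply: IH => //; exists (y p) => K; rewrite -(contr_coef_head m K ps).
apply: (indepB (c := fun i => contr_coef m (p :: s) i K) (d := fun i => contr (u 0) (y i) K)).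
rewrite -contr_wedge_cols -contr_sum.
have -> : (fun K => \sum_i x 0 i *: y i K) =
    (fun K => wedge_cols m (p :: s) K - contr (u 0) b K) by apply: funext => K'; rewrite -yE.
by rewrite contrB contr_contr subr0.
Qed.

Lemma colon_det_sub (m : M) :
  \det W *: m \in ideal_mod (ideal x) M -> m \in ideal_mod (ideal u) M.
Proof.
move=> Wm; apply: (contr_descent (s := enum 'I_n)); first exact: enum_uniq.
(* The product of all columns is \det W m in top degree, already 0 modulo J_x M, so the descent
   starts from the zero boundary. *)
exists (fun=> 0) => K; rewrite /contr big1 => [|j _]; last by rewrite scaler0.
by rewrite subr0 /wedge_cols wedges_full; case: ifP; rewrite ?rpred0.
Qed.

(* If u ^ t has coefficients in J_x M, write it as \sum_i x_i y_i: then y_p has the same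
   property since u ^ u ^ t = 0, and the adjunction between contr and wedge gives
   <W_p ^ W_s, y_p> = <W_s, t> modulo J_x M. *)
Lemma wedge_ascent m s : uniq s ->
  (forall i, u 0 i *: m \in ideal_mod (ideal x) M) ->
  exists t : {set 'I_n} -> M,
    (forall K, wedge (u 0) t K \in ideal_mod (ideal x) M) /\
    m - pairing (wedge_cols (1 : A^o) s) t \in ideal_mod (ideal x) M.
Proof.
move=> us mu; elim: s us => [_|p s IH]; last rewrite cons_uniq => /andP[ps us].
  exists (one_at m); split=> [K|].
    apply: rpred_sum => j _; rewrite mulrC -scalerA /one_at.
    case: ifP => _; last by rewrite !scaler0 rpred0.
    by rewrite scalerA mulrC -scalerA rpredZ.
  rewrite /pairing /wedge_cols (bigD1 finset.set0) // [wedges _ _ _]/= /one_at eqxx scale1r.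
  rewrite big1 => [|K /negPf ->].
    by rewrite [X in m - X]addr0 subrr rpred0.
  by rewrite scaler0.
have [t [tE tm]] := IH us; have [y yE] := ideal_mod_choice tE.
exists (y p); split=> [K|].
  rewrite -[wedge _ _ _]subr0.
  apply: (indepB (c := fun i => wedge (u 0) (y i) K) (d := fun=> 0)).
  rewrite -wedge_sum [RHS]big1 => [|i _]; last by rewrite scaler0.
  have -> : (fun K => \sum_i x 0 i *: y i K) = wedge (u 0) t by apply: funext => K'.
  by rewrite wedge_wedge.
rewrite -[m](subrK (pairing (wedge_cols (1 : A^o) s) t)) -addrA rpredD //.
have -> : wedge_cols (1 : A^o) s = contr_coef (1 : A^o) (p :: s) p.
  by apply: funext => K; rewrite contr_coef_head.
(* Both families are coefficients of the x_i in <W_p ^ W_s, u ^ t>: one after moving u to the left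
   as a contraction, the other after expanding u ^ t as \sum_i x_i y_i. *)
apply: (indepB (c := fun i => pairing (contr_coef (1 : A^o) (p :: s) i) t)
               (d := fun i => pairing (wedge_cols (1 : A^o) (p :: s)) (y i))).
rewrite -pairing_sum -pairing_suml.
have -> : (fun K => \sum_i x 0 i *: y i K) = wedge (u 0) t by apply: funext => K'.
rewrite pairing_wedge; congr (pairing _ t); apply: funext => K.
exact/esym/(contr_wedge_cols (1 : A^o) (p :: s) K).
Qed.

Lemma colon_ideal_sub (m : M) :
  (forall i, u 0 i *: m \in ideal_mod (ideal x) M) ->
  exists m', m - \det W *: m' \in ideal_mod (ideal x) M.
Proof.
move=> mu; have [t [_ tm]] := wedge_ascent (enum_uniq 'I_n) mu.
(* The product of all columns lives on the full set, so only the top coefficient of t contributes to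
   the pairing. *)
exists (t [set: 'I_n]); move: tm; rewrite /pairing (bigD1 [set: 'I_n]) //.
rewrite /wedge_cols wedges_full eqxx big1 => [|K /negPf KT]; last by rewrite wedges_full KT scale0r.
by rewrite [X in m - X \in _ -> _]addr0 (_ : \det W *: (1 : A^o) = \det W) //; exact: mulr1.
Qed.

End Independence.

(** * Matrices acting on families of module elements, and Cramer's rule *)

Section MatrixAction.
Variables (A : comPzRingType) (M : lmodType A).

Lemma sum_mulmx p q r (B : 'M[A]_(p, q)) (C : 'M[A]_(q, r)) (c : 'I_r -> M) i :
  \sum_j (B *m C) i j *: c j = \sum_k B i k *: \sum_j C k j *: c j.
Proof.
under eq_bigr => j _ do rewrite mxE scaler_suml.
rewrite exchange_big; apply: eq_bigr => k _; rewrite scaler_sumr.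
by apply: eq_bigr => j _; rewrite scalerA.
Qed.

Lemma sum_scalar_mx p (a : A) (c : 'I_p -> M) i : \sum_j (a%:M : 'M_p) i j *: c j = a *: c i.
Proof.
rewrite (bigD1 i) //= mxE eqxx big1 ?addr0 // => j ji.
by rewrite mxE eq_sym (negPf ji) scale0r.
Qed.

Lemma det_relations r (g : 'I_r -> M) (X : 'M[A]_r) j :
  relations g X -> \det X *: g j = 0.
Proof.
move=> gX; rewrite -sum_scalar_mx -mul_adj_mx sum_mulmx big1 // => k _.
by rewrite gX scaler0.
Qed.

End MatrixAction.

(** * Colon submodules and annihilators of quotients *)

Section Colon.
Variable A : comPzRingType.

Lemma smul_scale (V : lmodType A) (a : A) (I : idealT A) (N P : submodClosed V) :
  (forall (b : A) y, (b : A^o) \in I -> y \in N -> a *: (b *: y) \in P) ->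
  forall m, m \in smul I N -> a *: m \in P.
Proof.
move=> aI; pose S : {pred V} := fun y => a *: y \in P.
have SE y : (y \in S) = (a *: y \in P) by [].
have SC : GRing.subsemimod_closed S.
  split; [split=> [|y z] | move=> b y]; rewrite !SE.
  - by rewrite scaler0 rpred0.
  - by move=> Py Pz; rewrite scalerDr rpredD.
  - by move=> Py; rewrite scalerA mulrC -scalerA rpredZ.
by apply: (smul_sub (P := mk_submod SC)).
Qed.

Lemma colonP (V : lmodType A) (N : submodClosed V) (I : idealT A) m :
  m \in colon N I <-> forall a : A, (a : A^o) \in I -> a *: m \in N.
Proof. by split=> [/asboolP|H]; last apply/asboolP. Qed.

Lemma colon_ideal_genP (V : lmodType A) (N : submodClosed V) n (u : 'rV[A]_n) m :
  m \in colon N (ideal u) <-> forall i, u 0 i *: m \in N.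
Proof.
rewrite colonP; split=> [H i|H a /idealP[c ->]]; first by apply: H; exact: mem_ideal.
by rewrite scaler_suml rpred_sum // => i _; rewrite -scalerA rpredZ.
Qed.

Lemma AnnP (V : lmodType A) (a : A) : (a : A^o) \in Ann V <-> forall t : V, a *: t = 0.
Proof. by split=> [/asboolP|H]; last apply/asboolP. Qed.

Lemma quot_pi_eq0 (V : lmodType A) (N : submodClosed V) y :
  quot_pi N y = 0 <-> y \in N.
Proof. by rewrite -(raddf0 (quot_pi N)) quot_piE subr0. Qed.

Lemma Ann_quotientP (V : lmodType A) (N : submodClosed V) (a : A) :
  (a : A^o) \in Ann (quotient N) <-> forall m : V, a *: m \in N.
Proof.
rewrite AnnP; split=> [H m|H t]; first by apply/quot_pi_eq0; rewrite linearZ /= H.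
by rewrite -[t]quot_repK -linearZ; apply/quot_pi_eq0.
Qed.

Lemma Ann_subquotP (V : lmodType A) (N P : submodClosed V) (a : A) :
  (a : A^o) \in Ann (subquot N P) <-> forall m : V, m \in N -> a *: m \in P.
Proof.
rewrite Ann_quotientP; split=> [H m Nm|H [m Nm]].
  by have := H (Submodule Nm); rewrite restrictE.
by rewrite restrictE; apply: H.
Qed.

(** Both sides say that a I M lies in N. Equalities of annihilators thereby reduce to equalities of
    colon submodules. *)
Lemma Ann_subquot_colon (M : lmodType A) (I : idealT A) (N : submodClosed M) (a : A) :
  (a : A^o) \in Ann (subquot (ideal_mod I M) N)
    <-> forall m : M, a *: m \in colon N I.
Proof.
rewrite Ann_subquotP; split=> [H m|H m Im].
  by apply/colonP => b Ib; rewrite scalerA mulrC -scalerA H // smul_mem.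
apply: smul_scale Im => b y Ib _.
by have /colonP := H y; rewrite scalerA mulrC -scalerA; apply.
Qed.

End Colon.

(** * From x to u through W: independence, colons and annihilators *)

Section ChangeOfGenerators.
Variables (A : comPzRingType) (M : lmodType A) (n : nat) (x u : 'rV[A]_n).

Lemma ideal_sub_matrix : {subset ideal x <= ideal u} -> exists W : 'M[A]_n, x = u *m W.
Proof.
move=> xu; have /choice[c cE] : forall i, exists c : 'I_n -> A, x 0 i = \sum_j c j * u 0 j.
  by move=> i; apply/idealP/xu; exact: mem_ideal.
exists (\matrix_(j, i) c i j); apply/rowP => i; rewrite cE mxE.
by apply: eq_bigr => j _; rewrite mxE mulrC.
Qed.

Variable W : 'M[A]_n.
Hypothesis xuW : x = u *m W.
Let JxD := addsub (ideal x) (principal (\det W)).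

Lemma x_adj : x *m \adj W = \det W *: u.
Proof. by rewrite xuW -mulmxA mul_mx_adj mul_mx_scalar. Qed.

Lemma det_mul_ideal i : (\det W * u 0 i : A^o) \in ideal x.
Proof.
apply/idealP; exists (fun j => (\adj W) j i); have /rowP/(_ i) := x_adj.
by rewrite !mxE => <-; apply: eq_bigr => j _; rewrite mulrC.
Qed.

Lemma mem_JxD (a : A) : (a : A^o) \in JxD <->
  exists b c : A, (b : A^o) \in ideal x /\ a = b + c * \det W.
Proof.
rewrite addsubP; split=> [[p [q [px /principalP[c ->] ->]]]|[b [c [bx ->]]]].
  by exists p, c.
by exists b, (c * \det W); split=> //; apply/principalP; exists c.
Qed.

(** By Cramer's rule \Delta J_u lies in J_x; this yields the easy inclusion in both colon
    formulas. *)
Lemma JxD_mul (a b : A) : (a : A^o) \in JxD -> (b : A^o) \in ideal u ->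
  (a * b : A^o) \in ideal x.
Proof.
move=> /mem_JxD[p [c [px ->]]] /idealP[d ->]; rewrite mulrDl rpredD //.
  by rewrite mulrC; apply: (@rpredZ _ A^o).
rewrite mulr_sumr rpred_sum // => i _.
rewrite (_ : _ * _ = (c * d i) * (\det W * u 0 i)); last by rewrite mulrACA.
by apply: (@rpredZ _ A^o); exact: det_mul_ideal.
Qed.

Hypothesis xM : independent M x.

Lemma independent_u : independent M u.
Proof.
move=> m um0 i; apply: (colon_det_sub xM xuW).
rewrite -sum_scalar_mx -mul_mx_adj sum_mulmx rpred_sum // => k _; rewrite rpredZ //.
apply: (xM (m := fun k => \sum_j (\adj W) k j *: m j)); rewrite -sum_mulmx x_adj.
under eq_bigr => j _ do rewrite mxE -scalerA.
by rewrite -scaler_sumr um0 scaler0.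
Qed.

Lemma colon_u : colon (ideal_mod (ideal x) M) (ideal u) =i ideal_mod JxD M.
Proof.
move=> m; apply/idP/idP => [/colon_ideal_genP mu|mD].
  have [m' mm'] := colon_ideal_sub xM xuW mu.
  rewrite -[m](subrK (\det W *: m')) rpredD //; last first.
    by apply: smul_mem => //; apply/mem_JxD; exists 0, 1; rewrite rpred0 add0r mul1r.
  apply: smul_subl mm' => a ax; apply/mem_JxD; exists a, 0.
  by rewrite mul0r addr0.
apply/colonP => a au; apply: smul_scale mD => b y bD _.
by rewrite scalerA mulrC smul_mem // JxD_mul.
Qed.

Lemma colon_JxD : colon (ideal_mod (ideal x) M) JxD =i ideal_mod (ideal u) M.
Proof.
move=> m; apply/idP/idP => [/colonP mD|mu].
  apply: (colon_det_sub xM xuW); apply: mD.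
  by apply/mem_JxD; exists 0, 1; rewrite rpred0 add0r mul1r.
apply/colonP => a aD; apply: smul_scale mu => b y bu _.
by rewrite scalerA smul_mem // JxD_mul.
Qed.

Lemma Ann_subquot_u : Ann (subquot (ideal_mod (ideal u) M) (ideal_mod (ideal x) M))
  =i Ann (quotient (ideal_mod JxD M)).
Proof.
move=> a; apply/idP/idP => [/Ann_subquot_colon|/Ann_quotientP] H;
  [apply/Ann_quotientP | apply/Ann_subquot_colon => //] => m; have := H m; by rewrite colon_u.
Qed.

Lemma Ann_subquot_JxD : Ann (subquot (ideal_mod JxD M) (ideal_mod (ideal x) M))
  =i Ann (quotient (ideal_mod (ideal u) M)).
Proof.
move=> a; apply/idP/idP => [/Ann_subquot_colon|/Ann_quotientP] H;
  [apply/Ann_quotientP | apply/Ann_subquot_colon => //] => m; have := H m; by rewrite colon_JxD.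
Qed.

Hypothesis AnnM : Ann (quotient (ideal_mod (ideal x) M)) =i ideal x.

(** Multiplying a relation \sum_i x_i a_i = 0 by any m gives a relation in M, so a_i M lies in J_x M
    and a_i in the annihilator J_x. *)
Lemma independent_regular : independent A^o x.
Proof.
move=> a xa0 i; rewrite ideal_mod_regular -AnnM; apply/Ann_quotientP => m.
apply: (xM (m := fun i => (a i : A) *: m)).
under eq_bigr => j _ do rewrite scalerA.
by rewrite -scaler_suml -[RHS](scale0r m); congr (_ *: _).
Qed.

(** a M lies in K M = (J_x M : I) exactly when a I kills M / J_x M, that is, when a I lies in
    J_x. *)
Lemma Ann_quotient_colon (I K : idealT A) :
  colon (ideal_mod (ideal x) M) I =i ideal_mod K M ->
  Ann (quotient (ideal_mod K M)) =i colon (ideal x) I.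
Proof.
move=> IK a; apply/idP/idP => [/Ann_quotientP H|/colonP H].
  apply/colonP => b Ib; rewrite -AnnM; apply/Ann_quotientP => m.
  by have := H m; rewrite -IK => /colonP /(_ b Ib); rewrite scalerA.
apply/Ann_quotientP => m; rewrite -IK; apply/colonP => b Ib.
by rewrite scalerA smul_mem //; exact: H.
Qed.

End ChangeOfGenerators.

Lemma colon_regular (A : comPzRingType) (I J : idealT A) :
  colon (ideal_mod I A^o) J =i colon I J.
Proof.
by move=> a; apply/idP/idP => /colonP H; apply/colonP => b /H; rewrite ideal_mod_regular.
Qed.

(** * The initial Fitting ideal of J_u / J_x *)

Section FittingIdeal.
Variables (A : comPzRingType) (n : nat) (u : 'rV[A]_n) (J : idealT A).
Notation Q := (ideal_quot (ideal u) J).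

Definition quot_gen (i : 'I_n) : Q :=
  quot_pi (restrict (ideal u) J) (Submodule (mem_ideal u i)).

Lemma quot_proj_scale (a : A) (y : submodule (ideal u)) :
  quot_proj J a *: (quot_pi (restrict (ideal u) J) y : Q)
    = quot_pi (restrict (ideal u) J) (a *: y).
Proof. by rewrite [LHS]ideal_quot_scaleE -linearZ. Qed.

Lemma quot_gen_generates : generates quot_gen.
Proof.
move=> y; rewrite [RHS]/= -[y](quot_repK (y : subquot (ideal u) J)).
case: (quot_rep _) => a au; have /idealP[c ac] := au.
have -> : Submodule au = \sum_i c i *: Submodule (mem_ideal u i).
  by apply: val_inj; rewrite raddf_sum.
rewrite linear_sum; apply: rpred_sum => i _; rewrite [X in X \in _]/= -quot_proj_scale.
by apply: rpredZ; apply: mem_span; exists i.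
Qed.

Lemma quot_gen_kill (a : A) i :
  quot_proj J a *: quot_gen i = 0 <-> (a * u 0 i : A^o) \in J.
Proof. by rewrite quot_proj_scale quot_pi_eq0 restrictE. Qed.

End FittingIdeal.

Lemma Fit_ideal_quot (A : comPzRingType) n (x u : 'rV[A]_n) (W : 'M[A]_n) :
  x = u *m W ->
  colon (ideal x) (ideal u) =i addsub (ideal x) (principal (\det W)) ->
  Fit (ideal_quot (ideal u) (ideal x)) =i principal (quot_proj (ideal x) (\det W)).
Proof.
move=> xuW xu d; rewrite (FitE (@quot_gen_generates _ _ u (ideal x))).
apply/idP/idP; move: d; apply: span_sub => d; last first.
  (* Relations are rows, hence the transpose: the columns of W express the x_i, which vanish modulo
     J_x, in terms of the u_j. *)
  move=> ->; apply: mem_span; exists (map_mx (quot_proj (ideal x)) W^T).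
    move=> i; under eq_bigr => j _ do rewrite !mxE quot_proj_scale.
    rewrite -linear_sum; apply/quot_pi_eq0; rewrite restrictE raddf_sum /=.
    have := mem_ideal x i; rewrite {1}xuW mxE => xi.
    rewrite (eq_bigr (fun j => u 0 j * W j i)) // => j _.
    exact: mulrC.
  by rewrite det_map_mx det_tr.
case=> X gX ->; rewrite -[\det X]quot_reprK.
(* A lift of the determinant multiplies each u_i into J_x, so it lies in J_x + (\Delta). *)
have : (quot_repr (\det X) : A^o) \in colon (ideal x) (ideal u).
  apply/colon_ideal_genP => i.
  have /quot_gen_kill : quot_proj (ideal x) (quot_repr (\det X)) *: quot_gen u (ideal x) i = 0.
    by rewrite quot_reprK; apply: det_relations.
  by rewrite mulrC.
rewrite xu => /mem_JxD[b [c [bx ->]]]; apply/principalP; exists (quot_proj (ideal x) c).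
rewrite rmorphD rmorphM /= -[RHS]add0r; congr (_ + _).
by rewrite -(raddf0 (quot_proj (ideal x))); apply/quot_proj_eq; rewrite subr0.
Qed.

(** * Nakayama's lemma, for ideals in the Jacobson radical and for nilpotent ideals *)

Section Nakayama.
Variable A : comPzRingType.

Lemma ideal1 (I : idealT A) : (1 : A^o) \in I -> I =i fullsub A^o.
Proof.
move=> I1 a; rewrite [RHS]/=; have -> : a = (a : A) *: (1 : A^o) by rewrite [RHS]mulr1.
by rewrite rpredZ.
Qed.

Lemma exists_maximal_ideal (I : idealT A) : (1 : A^o) \notin I ->
  exists2 m : idealT A, maximal_ideal m & {subset I <= m}.
Proof.
move=> I1; pose proper_over (X : set A^o) (N : idealT A) :=
  [/\ X = [set a | a \in N]%classic, {subset I <= N} & (1 : A^o) \notin N].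
(* Zorn_bigcup asks for the union of the empty chain too, hence the alternative X = set0 *)
pose P (X : set A^o) := X = classical_sets.set0 \/ exists N, proper_over X N.
have [F FP Ftot|X [PX Xmax]] := @Zorn_bigcup A^o P.
  have FN X a : F X -> X a -> exists N, proper_over X N.
    by move=> FX Xa; case: (FP _ FX) => // X0; move: Xa; rewrite X0.
  have [[X0 [FX0 [N0 [X0E IN0 _]]]]|noF] :=
    EM (exists X, F X /\ exists N, proper_over X N); last first.
    left; apply/seteqP; split=> // a [X FX Xa].
    by apply: noF; exists X; split=> //; apply: FN Xa.
  right; pose U : {pred A^o} := fun a => `[< (\bigcup_(X in F) X)%classic a >].
  have UC : GRing.subsemimod_closed U.
    split; [split=> [|a b] | move=> c a].
    - by apply/asboolP; exists X0 => //; rewrite X0E /= rpred0.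
    - move=> /asboolP[X FX Xa] /asboolP[Y FY Yb]; apply/asboolP.
      case: (Ftot _ _ FX FY) => XY.
        have [N [YE _ _]] := FN _ _ FY Yb; exists Y => //.
        by move: (XY _ Xa) Yb; rewrite YE /= => ? ?; rewrite rpredD.
      have [N [XE _ _]] := FN _ _ FX Xa; exists X => //.
      by move: (XY _ Yb) Xa; rewrite XE /= => ? ?; rewrite rpredD.
    - move=> /asboolP[X FX Xa]; apply/asboolP; have [N [XE _ _]] := FN _ _ FX Xa.
      by exists X => //; move: Xa; rewrite XE /= => ?; rewrite rpredZ.
  exists (mk_submod UC); split.
  - by apply/seteqP; split=> a /= Ha; [apply/asboolP | move/asboolP: Ha].
  - by move=> a /IN0 aN; apply/asboolP; exists X0 => //; rewrite X0E.
  - apply/negP => /asboolP[X FX X1]; have [N [XE _ /negP N1]] := FN _ _ FX X1.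
    by apply: N1; move: X1; rewrite XE.
case: PX => [X0|[N [XE IN N1]]].
  (* An empty set is not maximal: I contains 0 and is strictly larger. *)
  have : P [set a | a \in I]%classic by right; exists I; split.
  move=> PI; exfalso; apply: Xmax PI; rewrite X0; split=> // /(_ 0); apply.
  by rewrite /= rpred0.
exists N => //; split=> [Nfull|J NJ]; first by move: N1; rewrite Nfull.
have [J1|J1] := boolP ((1 : A^o) \in J); first by right; apply: ideal1.
left; apply: contrapT => JN; apply: (Xmax [set a | a \in J]%classic).
  rewrite XE; split=> [a /NJ //|JsubN]; apply: JN => a.
  by apply/idP/idP => [/JsubN|/NJ].
by right; exists J; split=> // a /IN /NJ.
Qed.

(** Otherwise some maximal ideal contains c; it also contains 1 - c, hence 1. *)
Lemma jacobson_unit (c : A) : (1 - c : A^o) \in jacobson A -> exists b, b * c = 1.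
Proof.
move=> /asboolP cJ; have [/principalP[b bc]|c1] := boolP ((1 : A^o) \in principal c).
  by exists b.
have [m mmax cm] := exists_maximal_ideal c1; case: (mmax) => mfull _; exfalso; apply: mfull.
apply: ideal1; rewrite -[1](subrK (c : A^o)) rpredD ?cJ // cm //.
by apply: mem_span.
Qed.

(** Modulo I the matrix 1 - B becomes the identity. *)
Lemma det_1sub_ideal (I : idealT A) k (B : 'M[A]_k) :
  (forall i j, (B i j : A^o) \in I) -> (1 - \det (1%:M - B) : A^o) \in I.
Proof.
move=> BI; apply/quot_proj_eq; rewrite rmorph1 -det_map_mx.
rewrite -[LHS](@det1 _ k); congr (\det _); apply/matrixP => i j; rewrite [RHS]mxE.
have -> : (1%:M - B) i j = (i == j)%:R - B i j by rewrite !mxE.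
have BI0 : quot_proj I (B i j) = 0.
  by rewrite -(raddf0 (quot_proj I)); apply/quot_proj_eq; rewrite subr0.
by rewrite mxE rmorphB rmorph_nat /= BI0 subr0.
Qed.

Lemma smul_span (V : lmodType A) (I : idealT A) k (g : 'I_k -> V) :
  generates g -> forall y, y \in ideal_mod I V ->
  exists2 b : 'I_k -> A, forall i, (b i : A^o) \in I & y = \sum_i b i *: g i.
Proof.
move=> gV; pose S : {pred V} := fun y =>
  `[< exists2 b : 'I_k -> A, forall i, (b i : A^o) \in I & y = \sum_i b i *: g i >].
have SC : GRing.subsemimod_closed S.
  split; [split=> [|y1 y2] | move=> a y1].
  - apply/asboolP; exists (fun=> 0) => [i|]; first exact: rpred0.
    by rewrite big1 // => i _; rewrite scale0r.
  - move=> /asboolP[b bI ->] /asboolP[c cI ->]; apply/asboolP.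
    exists (fun i => b i + c i) => [i|]; first by rewrite rpredD ?bI ?cI.
    by rewrite -big_split; apply: eq_bigr => i _; rewrite scalerDl.
  - move=> /asboolP[b bI ->]; apply/asboolP; exists (fun i => a * b i) => [i|].
      by apply: (@rpredZ _ A^o); exact: bI.
    by rewrite scaler_sumr; apply: eq_bigr => i _; rewrite scalerA.
move=> y yI; apply/asboolP; move: y yI; apply: (smul_sub (P := mk_submod SC)).
move=> a y Ia _; have /span_rangeP[c ->] : y \in Defs.span (range g) by rewrite gV.
apply/asboolP; exists (fun i => a * c i) => [i|].
  by rewrite mulrC; apply: (@rpredZ _ A^o).
by rewrite scaler_sumr; apply: eq_bigr => i _; rewrite scalerA.
Qed.

(** Determinant trick: generators satisfy g = B g with B over I, so \det(1 - B) kills them, and it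
    is a unit. *)
Lemma nakayama (V : lmodType A) (I : idealT A) :
  finite_type V -> {subset I <= jacobson A} ->
  (forall y : V, y \in ideal_mod I V) -> forall y : V, y = 0.
Proof.
move=> [k [g gV]] IJ VI.
have /choice[b bE] : forall i, exists b : 'I_k -> A,
    (forall j, (b j : A^o) \in I) /\ g i = \sum_j b j *: g j.
  by move=> i; have [b bI gb] := smul_span gV (VI (g i)); exists b.
pose B : 'M[A]_k := \matrix_(i, j) b i j.
have gB : relations g (1%:M - B).
  move=> i; transitivity (g i - \sum_j b i j *: g j); last by rewrite -(bE i).2 subrr.
  rewrite -[g i]scale1r -(sum_scalar_mx 1 g i) -sumrB.
  by apply: eq_bigr => j _; rewrite !mxE scalerBl.
have [c cdet] : exists c, c * \det (1%:M - B) = 1.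
  apply: jacobson_unit; apply: IJ; apply: det_1sub_ideal => i j; rewrite mxE.
  by have [bI _] := bE i; apply: bI.
have g0 i : g i = 0.
  by rewrite -[g i]scale1r -cdet -scalerA det_relations // scaler0.
move=> y; have /span_rangeP[d ->] : y \in Defs.span (range g) by rewrite gV.
by rewrite big1 // => i _; rewrite g0 scaler0.
Qed.

(** Iterating V = I V gives V = I^l V for all l, and some power of I is 0. *)
Lemma nilpotent_nakayama (V : lmodType A) (I : idealT A) :
  nilpotent_ideal I -> (forall y : V, y \in ideal_mod I V) -> forall y : V, y = 0.
Proof.
move=> [k Ik0] VI.
have Vk l (y : V) : y \in ideal_mod (ideal_pow I l) V.
  elim: l y => [|l IH] y; first by rewrite -[y]scale1r; apply: smul_mem.
  move: (VI y); apply: smul_sub => a z Ia _; apply: smul_scale (IH z) => b t Ib _.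
  by rewrite scalerA; apply: smul_mem => //; apply: (smul_mem (V := A^o)).
move=> y; apply/eqP; have := Vk k y.
have zC : GRing.subsemimod_closed (fun y : V => y == 0).
  split; [split=> [|y1 y2] | move=> a y1]; rewrite !unfold_in.
  - by [].
  - by move=> /eqP-> /eqP->; rewrite addr0.
  - by move=> /eqP->; rewrite scaler0.
apply: (smul_sub (P := mk_submod zC)) => a t /Ik0 -> _.
by rewrite unfold_in /= scale0r.
Qed.

End Nakayama.

(** * Lower bounds on the number of generators *)

Section NumberOfGenerators.
Variable A : comPzRingType.

Lemma gen_by_ideal n (v : 'rV[A]_n) : gen_by (submodule (ideal v)) n.
Proof.
exists (fun i => Submodule (mem_ideal v i)) => -[a av]; rewrite [RHS]/=.
have /idealP[c ac] := av.
have -> : Submodule av = \sum_i c i *: Submodule (mem_ideal v i).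
  by apply: val_inj; rewrite raddf_sum.
by apply: rpred_sum => i _; apply: rpredZ; apply: mem_span; exists i.
Qed.

Lemma gen_by_ideal_row (J : idealT A) l :
  gen_by (submodule J) l -> exists v : 'rV[A]_l, ideal v =i J.
Proof.
move=> [g gJ]; exists (\row_i val (g i)) => a; apply/idP/idP => [|Ja].
  by move: a; apply: ideal_sub => i; rewrite mxE; exact: valP.
have /span_rangeP[c /(congr1 val)] : Submodule Ja \in Defs.span (range g) by rewrite gJ.
rewrite raddf_sum /= => aE; apply/idealP; exists c; rewrite aE.
by apply: eq_bigr => i _; rewrite mxE.
Qed.

Lemma ideal_pad l n (v : 'rV[A]_l) : (l < n)%N ->
  exists2 w : 'rV[A]_n, ideal w =i ideal v & exists i, w 0 i = 0.
Proof.
move=> ln; pose w : 'rV[A]_n := \row_i if insub (val i) is Some k then v 0 k else 0.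
exists w; last by exists (Ordinal ln); rewrite mxE insubF //= ltnn.
move=> a; apply/idP/idP; move: a; apply: ideal_sub => i.
  by rewrite mxE; case: insub => [k|]; [exact: mem_ideal|exact: rpred0].
have -> : v 0 i = w 0 (widen_ord (ltnW ln) i); last exact: mem_ideal.
rewrite mxE (insubT (fun k => (k < l)%N) (ltn_ord i)) /=.
by congr (v 0 _); apply: val_inj.
Qed.

Variables (M : lmodType A) (n : nat) (x u : 'rV[A]_n) (J : idealT A).
Hypotheses (xM : independent M x) (xJ : {subset ideal x <= J}).

(* Padding fewer than n generators by zeros gives an M-independent sequence which
   contains 0, and then any m is a coefficient of a relation. *)
Lemma few_generators l : gen_by (submodule J) l -> (l < n)%N ->
  forall m : M, m \in ideal_mod J M.
Proof.
move=> /gen_by_ideal_row[v vJ] /(ideal_pad v)[w wv [i wi0]] m.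
have xw : {subset ideal x <= ideal w} by move=> a /xJ; rewrite wv vJ.
have [W xwW] := ideal_sub_matrix xw.
have : m \in ideal_mod (ideal w) M.
  have := independent_u xwW xM (m := fun j => if j == i then m else 0).
  move=> /(_ _ i); rewrite eqxx; apply.
  by rewrite big1 // => j _; case: eqP => [->|_]; rewrite ?wi0 ?scale0r ?scaler0.
by apply: smul_subl => a; rewrite wv vJ.
Qed.

End NumberOfGenerators.

Theorem theorem3p4 (A : comPzRingType) (M : lmodType A) (n : nat)
    (x u : 'rV[A]_n) :
  {subset ideal x <= ideal u} ->
  independent M x ->
  [/\ independent M u,
      (exists W : 'M[A]_n, x = u *m W)
    & forall W : 'M[A]_n, x = u *m W ->
      let Jx := ideal x in
      let Ju := ideal u in
      let JxD := addsub Jx (principal (\det W)) in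
      [/\ [/\ colon (ideal_mod Jx M) Ju =i ideal_mod JxD M,
              colon (ideal_mod Jx M) JxD =i ideal_mod Ju M,
              Ann (subquot (ideal_mod Ju M) (ideal_mod Jx M))
                =i Ann (quotient (ideal_mod JxD M))
            & Ann (subquot (ideal_mod JxD M) (ideal_mod Jx M))
                =i Ann (quotient (ideal_mod Ju M))],
          Ann (quotient (ideal_mod Jx M)) =i Jx ->
          [/\ independent A^o x /\ independent A^o u,
              colon Jx Ju =i JxD /\ JxD =i Ann (quotient (ideal_mod JxD M)),
              colon Jx JxD =i Ju /\ Ju =i Ann (quotient (ideal_mod Ju M))
            & Fit (ideal_quot Ju Jx) =i principal (quot_proj Jx (\det W))]
        & (exists m : M, m <> 0) ->
          [\/ nilpotent_ideal Ju,
              finite_type M /\ {subset Ju <= jacobson A}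
            | Ann (quotient (ideal_mod Jx M)) =i Jx /\ ~ (Ju =i fullsub A^o)] ->
          [/\ \det W \notin Jx,
              min_ngens (submodule Ju) n
            & min_ngens (submodule Jx) n]]].
Proof.
move=> xu xM; have [W0 xuW0] := ideal_sub_matrix xu.
split; [exact: independent_u xuW0 xM | by exists W0 | move=> W xuW Jx Ju JxD].
have part3 : Ann (quotient (ideal_mod Jx M)) =i Jx ->
    [/\ independent A^o x /\ independent A^o u,
        colon Jx Ju =i JxD /\ JxD =i Ann (quotient (ideal_mod JxD M)),
        colon Jx JxD =i Ju /\ Ju =i Ann (quotient (ideal_mod Ju M))
      & Fit (ideal_quot Ju Jx) =i principal (quot_proj Jx (\det W))].
  move=> AnnM; have xA := independent_regular xM AnnM.
  (* As x is now A-independent, the colon formulas apply with M = A. *)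
  have xu_D : colon Jx Ju =i JxD.
    by move=> a; rewrite -colon_regular (colon_u xuW xA) ideal_mod_regular.
  have xD_u : colon Jx JxD =i Ju.
    by move=> a; rewrite -colon_regular (colon_JxD xuW xA) ideal_mod_regular.
  split; [split=> // | split=> // a | split=> // a | exact: Fit_ideal_quot].
  - exact: independent_u xuW xA.
  - by rewrite (Ann_quotient_colon AnnM (colon_u xuW xM)) xu_D.
  - by rewrite (Ann_quotient_colon AnnM (colon_JxD xuW xM)) xD_u.
split=> //; first by split; [exact: colon_u | exact: colon_JxD | exact: Ann_subquot_u
  | exact: Ann_subquot_JxD].
move=> [m0 m0N0] hyp.
(* All of (4) rests on M being different from J_u M. Cases (a) and (b) are Nakayama; in case (c), M
   = J_u M would put 1 in Ann(M / J_u M) = J_u. *)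
have JuM : ~ forall m : M, m \in ideal_mod Ju M.
  move=> MJu; case: hyp => [nilp|[ft Jac]|[AnnM Ju1]].
  - exact/m0N0/(nilpotent_nakayama nilp MJu).
  - exact/m0N0/(nakayama ft Jac MJu).
  - have [_ _ [_ JuE] _] := part3 AnnM.
    by apply: Ju1; apply: ideal1; rewrite JuE; apply/Ann_quotientP => m.
split.
(* If \Delta is in J_x then J_x + (\Delta) = J_x, and J_u M = (J_x M : J_x) = M. *)
- apply/negP => DJx; apply: JuM => m; rewrite -(colon_JxD xuW xM); apply/colonP => a aD.
  apply: smul_mem => //; have /mem_JxD[b [c [bx ->]]] := aD.
  by rewrite rpredD //; apply: (@rpredZ _ A^o).
- split=> [|l lJ]; first exact: gen_by_ideal.
  by rewrite leqNgt; apply/negP => ln; apply: JuM; exact: (few_generators xM xu lJ ln).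
- split=> [|l lJ]; first exact: gen_by_ideal.
  (* Too few generators of J_x give M = J_x M, which is contained in J_u M. *)
  rewrite leqNgt; apply/negP => ln; apply: JuM => m; apply: (smul_subl xu).
  exact: (few_generators xM (fun a ax => ax) lJ ln m).
Qed.
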